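(* Let $G$ be a finite group. Then $G$ is $(2,8)$-centralizer if and only if $G$ is a $7$-centralizer group with $Z(G)\neq 1$. Moreover, there is no primitive $(2,8)$-centralizer finite group.
   Context: All groups are finite. $Z(G)$ denotes the center of $G$. For a group $G$, $Cent(G)=\{C_G(x)\mid x\in G\}$ and $2\text{-}Cent(G) = \{ C_G(\{x,y\}) \mid x,y\in G,\ x\neq y\}$, where $C_G(\{x,y\}) = C_G(x)\cap C_G(y)$. A group $G$ is called $n$-centralizer if $|Cent(G)|=n$, $(2,n)$-centralizer if $|2\text{-}Cent(G)| = n$, and primitive $(2,n)$-centralizer if $|2\text{-}Cent(G)| = |2\text{-}Cent(G/Z(G))| = n$. *)

(* Defs.v *)
From mathcomp Require Import all_boot all_fingroup all_solvable.

Set Implicit Arguments.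
Unset Strict Implicit.
Unset Printing Implicit Defensive.

Local Open Scope group_scope.

Definition Cent (gT : finGroupType) (G : {group gT}) : {set {set gT}} :=
  [set 'C_G[x] | x in G].

Definition Cent2 (gT : finGroupType) (G : {group gT}) : {set {set gT}} :=
  [set 'C_G([set x; y]) | x in G, y in G & x != y].

Definition centralizer_group (n : nat) (gT : finGroupType)
    (G : {group gT}) : Prop :=
  #|Cent G| = n.

Definition centralizer2_group (n : nat) (gT : finGroupType)
    (G : {group gT}) : Prop :=
  #|Cent2 G| = n.

Definition primitive_centralizer2_group (n : nat) (gT : finGroupType)
    (G : {group gT}) : Prop :=
  #|Cent2 G| = n /\ #|Cent2 (G / 'Z(G))| = n.

Lemma cent_pairE (gT : finGroupType) (G : {group gT}) (x y : gT) :
  'C_G([set x; y]) = 'C_G[x] :&: 'C_G[y].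
Proof. by apply/setP=> z; rewrite centU !cent_set1 !inE; case: (z \in G). Qed.

(* Main.v *)
(* Two noncentral elements are equivalent when they have the same centralizer;
   let P = |Cent G| - 1 be the number of classes.  If some centralizer of a
   noncentral element is not abelian, a covering argument gives P >= 8.  So, for
   P <= 7, distinct proper centralizers are abelian and meet exactly in Z(G):
   they partition G modulo Z(G), and 2-Cent(G) consists of Z(G), the P proper
   centralizers, and G if Z(G) <> 1.  As P < |2-Cent(G)| for G nonabelian, only a
   centerless group with P = 7 has to be excluded; its centralizers are Hall
   subgroups of order at most 6, so that |G| <= 36 divides 60, and counting
   elements leaves only |G| = 30, with one (hence normal) centralizer of order
   6, whose involution would be central.  Finally, if P = 6 and G / Z(G) has a
   nontrivial center, then all elements of G / Z(G) have order at most 5, so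
   that it is a p-group; counting modulo p gives p = 5, and |G / Z(G)| <= 25
   forces it to be abelian. *)

Require Import Defs.
From mathcomp Require Import all_boot all_fingroup all_solvable.
From mathcomp Require Import zify.

Set Implicit Arguments.
Unset Strict Implicit.
Unset Printing Implicit Defensive.

Local Open Scope group_scope.

(** By [mem_centerE] these are the centralizers of elements of [G] that differ from [G]. As a set of
    sets it counts each one once, so its cardinality is the number [P] of classes. *)
Definition pCent (gT : finGroupType) (G : {group gT}) : {set {set gT}} :=
  [set 'C_G[x] | x in G :\: 'Z(G)].

(** * Basic facts on centralizers of noncentral elements *)

Section NoncentralCentralizers.

Variables (gT : finGroupType) (G : {group gT}).
Implicit Types (x y : gT) (D E : {set gT}).

Lemma mem_cent1 x y : (y \in 'C_G[x]) = (y \in G) && (x * y == y * x).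
Proof.
rewrite in_setI; congr (_ && _).
by apply/cent1P/eqP => /esym.
Qed.

Lemma mem_cent1C x y : x \in G -> y \in 'C_G[x] -> x \in 'C_G[y].
Proof. by move=> xG; rewrite !mem_cent1 xG => /andP[_ /eqP->] /=. Qed.

Lemma cent1_id x : x \in G -> x \in 'C_G[x].
Proof. by move=> xG; rewrite mem_cent1 xG /=. Qed.

Lemma center_sub_cent1 x : x \in G -> 'Z(G) \subset 'C_G[x].
Proof.
move=> xG; apply/subsetP=> z /centerP[zG cz].
by rewrite mem_cent1 zG cz //=.
Qed.

Lemma mem_centerE x : x \in G -> (x \in 'Z(G)) = ('C_G[x] == G).
Proof.
move=> xG; apply/idP/eqP => [/centerP[_ cx]|CG].
  apply/setP=> y; rewrite mem_cent1; case yG: (y \in G) => //=.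
  by rewrite cx ?eqxx.
apply/centerP; split=> // y; rewrite -{1}CG mem_cent1 => /andP[_ /eqP].
by [].
Qed.

Lemma pCentP D :
  reflect (exists x, [/\ x \in G, x \notin 'Z(G) & D = 'C_G[x]])
          (D \in pCent G).
Proof.
apply: (iffP imsetP) => [[x]|[x [xG xZ ->]]].
  by rewrite inE => /andP[xZ xG] ->; exists x.
by exists x => //; rewrite inE xZ.
Qed.

Lemma cent1_pCent x : x \in G -> x \notin 'Z(G) -> 'C_G[x] \in pCent G.
Proof. by move=> xG xZ; apply/pCentP; exists x. Qed.

Lemma G_notin_pCent : gval G \notin pCent G.
Proof.
apply/negP=> /pCentP[x [xG]]; rewrite mem_centerE // => /eqP nG eG.
exact: nG.
Qed.

Lemma Z_notin_pCent : 'Z(G) \notin pCent G.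
Proof.
apply/negP=> /pCentP[x [xG /negP xZ eZ]]; apply: xZ.
by rewrite eZ cent1_id.
Qed.

Lemma CentE : Cent G = gval G |: pCent G.
Proof.
apply/setP=> D; rewrite !inE; apply/imsetP/orP.
  case=> x xG ->; case xZ: (x \in 'Z(G)).
    by left; rewrite -mem_centerE.
  by right; rewrite cent1_pCent // xZ.
case=> [/eqP->|/pCentP[x [xG _ ->]]]; last by exists x.
by exists 1; rewrite ?group1 //; apply/esym/eqP; rewrite -mem_centerE ?group1.
Qed.

Lemma card_Cent : #|Cent G| = #|pCent G|.+1.
Proof. by rewrite CentE cardsU1 G_notin_pCent. Qed.

(** * Fewer than eight proper centralizers are abelian *)

Lemma nonabelian_noncommuting (H : {group gT}) :
  ~~ abelian H -> exists2 a, a \in H & exists2 b, b \in H & a * b != b * a.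
Proof.
move=> nab; case: (boolP [exists a in H, exists b in H, a * b != b * a]).
  by case/exists_inP=> a aH /exists_inP[b bH nab']; exists a => //; exists b.
rewrite negb_exists_in => /forall_inP h; case/negP: nab.
apply/centsP=> a aH b bH; move: (h a aH); rewrite negb_exists_in.
by move/forall_inP/(_ b bH); rewrite negbK => /eqP.
Qed.

(** Both inclusions in [B < B <*> <[x]> < H] are strict, the second because the middle group is
    still abelian; each index is at least 2. *)
Lemma quarter_abelian (H B : {group gT}) x :
  ~~ abelian H -> B \subset H -> abelian B -> x \in 'Z(H) -> x \notin B ->
  4 * #|B| <= #|H|.
Proof.
move=> nabH sBH abB /centerP[xH cx] xB.
have cBx : B \subset 'C(<[x]>).
  rewrite cent_cycle; apply/subsetP=> b bB; apply/cent1P.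
  by rewrite /commute cx // (subsetP sBH).
set K := (B <*> <[x]>)%G.
have abK : abelian K by rewrite abelianY abB cycle_abelian centsC.
have sKH : K \subset H by rewrite join_subG sBH cycle_subG.
have pBK : B \proper K.
  rewrite properE joing_subl; apply: contra xB => /subsetP; apply.
  by rewrite mem_gen // in_setU cycle_id orbT.
have pKH : K \proper H.
  rewrite properE sKH; apply: contra nabH => sHK; exact: abelianS abK.
have i1 : 1 < #|K : B| by rewrite indexg_gt1; case/andP: pBK.
have i2 : 1 < #|H : K| by rewrite indexg_gt1; case/andP: pKH.
rewrite -(Lagrange sKH) -(Lagrange (proper_sub pBK)) -mulnA mulnC leq_mul2l.
by rewrite (leq_mul i1 i2) orbT.
Qed.

(** If the intersection contains some [u], it lies in the coset [u *: (A :&: H)]. *)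
Lemma card_setI_lcoset (A H : {group gT}) g :
  #|A :&: g *: H| <= #|A :&: H|.
Proof.
case: (set_0Vmem (A :&: g *: H)) => [->|[u]]; first by rewrite cards0.
rewrite inE => /andP[uA ugH].
rewrite -(card_lcoset (A :&: H) u); apply: subset_leq_card.
apply/subsetP=> v; rewrite inE => /andP[vA vgH].
rewrite mem_lcoset inE groupM ?groupV //=.
by rewrite -mem_lcoset (lcoset_eqP ugH).
Qed.

(* If [H = 'C_G[x]] is not abelian, [x], [a], [b] and [a * b] have distinct
   centralizers containing [x] whenever [a] and [b] in [H] do not commute.  A
   coset [g *: H] outside [H] is covered by the centers of the centralizers of
   its elements; each of them covers at most a quarter of it, whence at least
   four more centralizers, which do not contain [x]. *)
Lemma abelian_pCent x :
  #|pCent G| < 8 -> x \in G -> x \notin 'Z(G) -> abelian 'C_G[x].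
Proof.
move=> ltC xG xZ; apply: contraLR ltC => nab; rewrite -leqNgt.
pose H := 'C_G[x]%G.
have [a aH [b bH cab]] := @nonabelian_noncommuting H nab.
have cxH h : h \in H -> h \in G /\ x * h = h * x.
  by rewrite mem_cent1 => /andP[hG /eqP].
have [aG cxa] := cxH _ aH; have [bG cxb] := cxH _ bH.
pose I := [set D in pCent G | x \in D].
pose O := [set D in pCent G | x \notin D].
have -> : #|pCent G| = #|I| + #|O|.
  rewrite -(cardsID [set D : {set gT} | x \in D] (pCent G)).
  by congr (_ + _); apply: eq_card => D; rewrite !inE // andbC.
have memI h : h \in H -> h \notin 'Z(G) -> 'C_G[h] \in I.
  move=> hH hZ; have [hG _] := cxH _ hH.
  by rewrite inE cent1_pCent //=; apply: mem_cent1C.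
have nZ h k : h \in G -> k \in G -> h * k != k * h -> h \notin 'Z(G).
  by move=> hG kG; apply: contra => /centerP[_ ->].
have neqC h k l : l \in 'C_G[h] -> l \notin 'C_G[k] -> 'C_G[h] != 'C_G[k].
  by move=> lh; apply: contra => /eqP <-.
have abG : a * b \in G by rewrite groupM.
have leI : 4 <= #|I|.
  have sI : [set 'C_G[x]; 'C_G[a]; 'C_G[b]; 'C_G[a * b]] \subset I.
    apply/subsetP=> D; rewrite !inE -!orbA => /or4P[]/eqP->.
    - by rewrite cent1_pCent // cent1_id.
    - by have := memI _ aH (nZ _ _ aG bG cab); rewrite inE.
    - by rewrite eq_sym in cab; have := memI _ bH (nZ _ _ bG aG cab); rewrite inE.
    have naba : a * b * a != a * (a * b).
      by rewrite -mulgA (inj_eq (mulgI a)) eq_sym.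
    have abH : a * b \in H by rewrite groupM.
    by have := memI _ abH (nZ _ _ abG aG naba); rewrite inE.
  apply: leq_trans (subset_leq_card sI).
  have cba : b * a != a * b by rewrite eq_sym.
  have [xa xb xab] : [/\ 'C_G[x] != 'C_G[a], 'C_G[x] != 'C_G[b]
                       & 'C_G[x] != 'C_G[a * b]].
    split; [apply: (neqC _ _ b) | apply: (neqC _ _ a) | apply: (neqC _ _ a)];
      rewrite ?mem_cent1 ?aG ?bG ?cxa ?cxb ?eqxx //=.
    by rewrite -mulgA (inj_eq (mulgI a)).
  have [ab' aab bab] : [/\ 'C_G[a] != 'C_G[b], 'C_G[a] != 'C_G[a * b]
                       & 'C_G[b] != 'C_G[a * b]].
    split; [apply: (neqC _ _ a) | apply: (neqC _ _ a) | apply: (neqC _ _ b)];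
      rewrite ?mem_cent1 ?aG ?bG ?eqxx //=.
    - by rewrite -mulgA (inj_eq (mulgI a)).
    - by rewrite mulgA (inj_eq (mulIg b)).
  rewrite -!setUA !cardsU1 cards1 !inE.
  by rewrite (negPf xa) (negPf xb) (negPf xab) (negPf ab') (negPf aab) (negPf bab).
suff leO : 4 <= #|O| by apply: leq_add leI leO.
have [g gG gH] : exists2 g, g \in G & g \notin H.
  apply/subsetPn; apply: contra xZ => sGH.
  by rewrite mem_centerE // eqEsubset sGH subsetIl.
have cov : g *: H \subset \bigcup_(D in O) ('Z(D) :&: g *: H).
  apply/subsetP=> y ygH; apply/bigcupP.
  have yG : y \in G.
    move: ygH => /lcosetP[h hH ->]; rewrite groupM //.
    by case: (cxH h hH).
  have yH : y \notin H.
    apply: contra gH => yH; move: ygH => /lcosetP[h hH ey].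
    by move: yH; rewrite ey groupMr.
  have xyC : x \notin 'C_G[y] by apply: contra yH; apply: mem_cent1C.
  exists 'C_G[y]; last first.
    rewrite inE ygH andbT; apply/centerP; split; first exact: cent1_id.
    by move=> z; rewrite mem_cent1 => /andP[_ /eqP].
  rewrite inE xyC cent1_pCent //; apply: contra xyC => /centerP[_ cy].
  by rewrite mem_cent1 xG cy ?eqxx.
have /(leq_trans (subset_leq_card cov)) : 
    #|\bigcup_(D in O) ('Z(D) :&: g *: H)| <= \sum_(D in O) #|'Z(D) :&: g *: H|.
  elim/big_rec2: _ => [|D n A _ le]; first by rewrite cards0.
  by apply: leq_trans (leq_card_setU _ _) _; rewrite leq_add2l.
rewrite card_lcoset => leH.
(* After translation into [H], the set to bound is the abelian subgroup ['Z('C_G[y]) :&: H]. It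
   misses [x], which is central in [H], so [quarter_abelian] applies. *)
have leD D : D \in O -> 4 * #|'Z(D) :&: g *: H| <= #|H|.
  rewrite inE => /andP[/pCentP[y [yG _ ->]] xy].
  apply: leq_trans (_ : 4 * #|'Z('C_G[y]) :&: H| <= _).
    by rewrite leq_mul2l card_setI_lcoset.
  apply: (@quarter_abelian H ('Z('C_G[y]) :&: H)%G x) => //.
  - exact: subsetIr.
  - exact: abelianS (subsetIl _ _) (center_abelian _).
  - by apply/centerP; split; [exact: cent1_id | move=> h /cxH[]].
  by apply: contra xy; rewrite inE => /andP[/(subsetP (center_sub _))].
have : 4 * #|H| <= #|O| * #|H|.
  apply: leq_trans (_ : \sum_(D in O) 4 * #|'Z(D) :&: g *: H| <= _).
    by rewrite -big_distrr /= leq_mul2l.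
  by rewrite -sum_nat_const; apply: leq_sum.
by rewrite leq_pmul2r ?cardG_gt0.
Qed.

(** * Comparison of 2-Cent(G) with the proper centralizers *)

Lemma Cent2P D :
  reflect (exists x y, [/\ x \in G, y \in G, x != y & D = 'C_G[x] :&: 'C_G[y]])
          (D \in Cent2 G).
Proof.
apply: (iffP imset2P) => [[x y xG]|[x [y [xG yG xy ->]]]].
  by rewrite inE => /andP[yG xy] ->; exists x, y; rewrite cent_pairE.
by exists x y => //; rewrite ?inE ?yG ?cent_pairE.
Qed.

Lemma mem_pCent_group D : D \in pCent G -> exists K : {group gT}, D = K.
Proof. by case/pCentP=> x [_ _ ->]; exists 'C_G[x]%G. Qed.

Lemma pCent_sub D : D \in pCent G -> D \subset G.
Proof. by case/pCentP=> x [_ _ ->]; apply: subsetIl. Qed.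

Lemma center_sub_pCent D : D \in pCent G -> 'Z(G) \subset D.
Proof. by case/pCentP=> x [xG _ ->]; apply: center_sub_cent1. Qed.

Lemma cent1_1 : 'C_G[1] = G.
Proof. by apply/eqP; rewrite -mem_centerE group1. Qed.

Lemma pCent_sub_Cent2 : pCent G \subset Cent2 G.
Proof.
apply/subsetP=> D /pCentP[x [xG xZ ->]]; apply/Cent2P.
exists x, 1; split=> //; last by rewrite cent1_1 (setIidPl (subsetIl _ _)).
by apply: contra xZ => /eqP->.
Qed.

(** [G] occurs only from two distinct central elements, one of which is then nontrivial; conversely
    a nontrivial central [z] is paired with 1. *)
Lemma G_in_Cent2 : (gval G \in Cent2 G) = ('Z(G) != 1).
Proof.
apply/Cent2P/trivgPn => [[x [y [xG yG xy eG]]]|[z zZ z1]].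
  have [xZ yZ] : x \in 'Z(G) /\ y \in 'Z(G).
    by rewrite !mem_centerE // !eqEsubset !subsetIl {1 3}eG subsetIl subsetIr.
  case: (eqVneq x 1) => [x1|]; last by exists x.
  by exists y => //; rewrite eq_sym -x1.
have zG := subsetP (center_sub G) z zZ.
exists z, 1; split=> //; rewrite cent1_1.
by move: zZ; rewrite mem_centerE // => /eqP->; rewrite setIid.
Qed.

Lemma nonabelian_noncentral : ~~ abelian G -> exists2 x, x \in G & x \notin 'Z(G).
Proof.
move=> nab; apply/subsetPn; apply: contra nab => sGZ.
exact: abelianS sGZ (center_abelian G).
Qed.

(* If every [C(x) :&: C(y)] with [x != y] were a proper centralizer, a minimal
   proper centralizer [C(w)] would lie in all of them, so that [w] would be
   central. *)
Lemma card_pCent_lt_Cent2 : ~~ abelian G -> #|pCent G| < #|Cent2 G|.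
Proof.
move=> /nonabelian_noncentral[x0 x0G x0Z].
apply: proper_card; rewrite properE pCent_sub_Cent2.
apply/negP=> /subsetP s2.
case: (@arg_minnP _ 'C_G[x0] (fun D => D \in pCent G) (fun D => #|D|)).
  exact: cent1_pCent.
move=> _ /pCentP[w [wG /negP wZ ->]] minw; apply: wZ.
apply/centerP; split=> // y yG; case: (eqVneq w y) => [->//|wy].
have /s2 /minw le : 'C_G[w] :&: 'C_G[y] \in Cent2 G by apply/Cent2P; exists w, y.
have sC : 'C_G[w] \subset 'C_G[y].
  by apply/setIidPl/eqP; rewrite eqEcard subsetIl le.
by have /(subsetP sC) := cent1_id wG; rewrite mem_cent1 => /andP[_ /eqP].
Qed.

Lemma pCent_abelian : abelian G -> pCent G = set0.
Proof. by move=> /center_idP ZG; rewrite /pCent ZG setDv imset0. Qed.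

Lemma card_Cent2_abelian : abelian G -> #|Cent2 G| <= 1.
Proof.
move=> /center_idP ZG; rewrite -(cards1 (gval G)); apply: subset_leq_card.
apply/subsetP=> D /Cent2P[x [y [xG yG _ ->]]].
have CG z : z \in G -> 'C_G[z] = G.
  by move=> zG; apply/eqP; rewrite -mem_centerE // ZG.
by rewrite !CG // setIid inE.
Qed.

(** * The partition of G modulo its center by abelian centralizers *)

Section AbelianCentralizers.

Hypothesis abC : forall x, x \in G -> x \notin 'Z(G) -> abelian 'C_G[x].

Lemma cent1_sub_noncentral x y :
  x \in G -> x \notin 'Z(G) -> y \in 'C_G[x] -> 'C_G[x] \subset 'C_G[y].
Proof.
move=> xG xZ yC; apply/subsetP=> z zC.
rewrite mem_cent1 (subsetP (subsetIl _ _) z zC) /=.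
by apply/eqP; apply: (centsP (abC xG xZ)).
Qed.

Lemma cent1_eq_noncentral x y :
  x \in G -> x \notin 'Z(G) -> y \in 'C_G[x] -> y \notin 'Z(G) ->
  'C_G[x] = 'C_G[y].
Proof.
move=> xG xZ yC yZ; have yG := subsetP (subsetIl _ _) y yC.
apply/eqP; rewrite eqEsubset !cent1_sub_noncentral //; exact: mem_cent1C.
Qed.

Lemma pCent_mem_eq D y :
  D \in pCent G -> y \in D -> y \notin 'Z(G) -> D = 'C_G[y].
Proof. by case/pCentP=> x [xG xZ ->]; apply: cent1_eq_noncentral. Qed.

(** By [pCent_mem_eq], a noncentral element of the intersection determines both centralizers. *)
Lemma pCent_setI D E : D \in pCent G -> E \in pCent G -> D != E ->
  D :&: E = 'Z(G).
Proof.
move=> DC EC; apply: contraNeq => neZ.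
have sZ : 'Z(G) \subset D :&: E by rewrite subsetI !center_sub_pCent.
have /subsetPn[w] : ~~ (D :&: E \subset 'Z(G)).
  by apply: contra neZ => sub; rewrite eqEsubset sub.
rewrite inE => /andP[wD wE] wZ.
by rewrite (pCent_mem_eq DC wD wZ) (pCent_mem_eq EC wE wZ).
Qed.

(** The sets [D :\: 'Z(G)] partition [G :\: 'Z(G)]; the count is arranged so that no natural-number
    subtraction occurs. *)
Lemma sum_card_pCent :
  (\sum_(D in pCent G) #|D| + #|'Z(G)| = #|G| + #|pCent G| * #|'Z(G)|)%N.
Proof.
have eN : #|G :\: 'Z(G)| = (\sum_(D in pCent G) #|D :\: 'Z(G)|)%N.
  rewrite -sum1_card (partition_big_imset (fun x => 'C_G[x])) /=.
  apply: eq_bigr => D DC; rewrite sum1_card; apply: eq_card => x.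
  rewrite unfold_in /= !in_setD; case xZ: (x \in 'Z(G)) => //=.
  apply/andP/idP => [[xG /eqP<-]|xD]; first exact: cent1_id.
  by rewrite -(pCent_mem_eq DC xD) ?xZ ?(subsetP (pCent_sub DC)).
have cD (A : {set gT}) : 'Z(G) \subset A -> (#|A :\: 'Z(G)| + #|'Z(G)| = #|A|)%N.
  by move=> sZA; rewrite -(cardsID 'Z(G) A) (setIidPr sZA) addnC.
rewrite -(cD G (center_sub G)) eN -sum_nat_const.
rewrite addnAC -big_split /=; congr (_ + _)%N.
by apply: eq_bigr => D DC; rewrite cD // center_sub_pCent.
Qed.

(** The product set [D * E] lies in [G] and has [#|D| * #|E| / #|D :&: E|] elements. *)
Lemma pCent_card_mul D E : D \in pCent G -> E \in pCent G -> D != E ->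
  (#|D| * #|E| <= #|G| * #|'Z(G)|)%N.
Proof.
move=> DC EC neDE; rewrite -(pCent_setI DC EC neDE).
have [[K eK] [L eL]] := (mem_pCent_group DC, mem_pCent_group EC).
rewrite eK eL mul_cardG leq_mul2r subset_leq_card ?orbT //.
by rewrite mul_subG // -?eK -?eL pCent_sub.
Qed.

Lemma pCent_card_lt D : D \in pCent G -> #|D| < #|G|.
Proof.
move=> DC; apply: proper_card; rewrite properEneq pCent_sub // andbT.
by apply: contraTneq DC => ->; apply: G_notin_pCent.
Qed.

(* Every other [E] satisfies [#|E| <= #|G| * #|Z| / #|D|] as [D :&: E = Z];
   insert this in the sum of [sum_card_pCent]. *)
Lemma leq_card_pCent D :
  D \in pCent G -> (#|D| <= #|pCent G|.-1 * #|'Z(G)|)%N.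
Proof.
move=> DC; have := sum_card_pCent; have := pCent_card_lt DC.
rewrite (bigD1 D DC) /= (cardsD1 D) DC /=.
set q := #|_ :\ _|; set R := (\sum_(_ | _) _)%N.
have leR : (#|D| * R <= q * (#|G| * #|'Z(G)|))%N.
  rewrite big_distrr /= /q -sum_nat_const.
  rewrite [X in (_ <= X)%N](eq_bigl (fun E => (E \in pCent G) && (E != D))).
    by apply: leq_sum => E /andP[EC neED]; rewrite pCent_card_mul // eq_sym.
  by move=> E; rewrite !inE andbC.
move: leR; rewrite add1n /=.
move: q R #|D| #|G| #|'Z(G)| => q R M N z leR ltMN eqR.
(* Substituting [R = N + q z - M] gives [M R - q N z = (M - q z)(N - M)], which would be positive if
   [q z < M], against [leR]. *)
by rewrite leqNgt; apply/negP=> ltqz; nia.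
Qed.

(** Bounding every term of [sum_card_pCent] by [leq_card_pCent] leaves the factor
    [P (P - 1) + 1 - P = (P - 1) ^ 2]. *)
Lemma leq_card_G : ~~ abelian G -> (#|G| <= #|pCent G|.-1 ^ 2 * #|'Z(G)|)%N.
Proof.
move=> /nonabelian_noncentral[x xG xZ].
have P0 : 0 < #|pCent G| by apply/card_gt0P; exists 'C_G[x]; apply: cent1_pCent.
have := sum_card_pCent.
have : (\sum_(D in pCent G) #|D| <= #|pCent G| * (#|pCent G|.-1 * #|'Z(G)|))%N.
  by rewrite -sum_nat_const; apply: leq_sum => D; apply: leq_card_pCent.
rewrite -{1 3}(prednK P0); move: (\sum_(_ in _) _)%N => S; nia.
Qed.

(** The last 1 counts ['Z(G)], which occurs as the intersection of the centralizers of two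
    noncommuting elements; the boolean counts [G]. *)
Lemma card_Cent2 :
  ~~ abelian G -> #|Cent2 G| = (#|pCent G| + ('Z(G) != 1%g) + 1)%N.
Proof.
move=> nab.
have -> : Cent2 G = 'Z(G) |: (pCent G :|: [set D : {set gT} | (D == G) && ('Z(G) != 1)]).
  apply/setP=> D; rewrite !inE; apply/idP/or3P.
    case/Cent2P=> x [y [xG yG xy eD]].
    case xZ: (x \in 'Z(G)); case yZ: (y \in 'Z(G)); rewrite eD.
    - have [eGx eGy] : 'C_G[x] = G /\ 'C_G[y] = G.
        by split; apply/eqP; rewrite -mem_centerE.
      apply: Or33; rewrite eGx eGy setIid eqxx -G_in_Cent2.
      by apply/Cent2P; exists x, y; rewrite eGx eGy setIid.
    - move: xZ; rewrite mem_centerE // => /eqP->.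
      by apply: Or32; rewrite (setIidPr (subsetIl _ _)) cent1_pCent ?yZ.
    - move: yZ; rewrite mem_centerE // => /eqP->.
      by apply: Or32; rewrite (setIidPl (subsetIl _ _)) cent1_pCent ?xZ.
    have [xC yC] : 'C_G[x] \in pCent G /\ 'C_G[y] \in pCent G.
      by rewrite !cent1_pCent ?xZ ?yZ.
    case: (eqVneq 'C_G[x] 'C_G[y]) => [->|ne].
      by apply: Or32; rewrite setIid.
    by apply: Or31; rewrite pCent_setI.
  case=> [/eqP->|DC|/andP[/eqP-> Z1]]; last by rewrite G_in_Cent2.
    have [a aG [b bG nab']] := nonabelian_noncommuting nab.
    have aZ : a \notin 'Z(G).
      by apply: contra nab' => /centerP[_ ca]; rewrite ca ?eqxx.
    have bZ : b \notin 'Z(G).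
      by apply: contra nab' => /centerP[_ cb]; rewrite cb ?eqxx.
    apply/Cent2P; exists a, b; split=> //.
      by apply: contra nab' => /eqP->.
    rewrite (@pCent_setI 'C_G[a] 'C_G[b]) ?cent1_pCent //.
    apply: contra nab' => /eqP eC; have := cent1_id bG.
    by rewrite -eC mem_cent1 => /andP[].
  exact: (subsetP pCent_sub_Cent2).
have Z_G : ('Z(G) == G :> {set gT}) = false.
  apply/negbTE; apply: contra nab => /eqP eZ.
  by rewrite -eZ center_abelian.
rewrite cardsU1 !inE (negbTE Z_notin_pCent) Z_G /= addnC.
congr (_ + _)%N; case: ('Z(G) != 1).
  rewrite (_ : [set D | _] = [set gval G]).
    by rewrite setUC cardsU1 G_notin_pCent addnC.
  by apply/setP=> D; rewrite !inE andbT.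
rewrite (_ : [set D | _] = set0) ?setU0 ?addn0 //.
by apply/setP=> D; rewrite !inE andbF.
Qed.

Lemma pCent_not_sub_center D : D \in pCent G -> ~~ (D \subset 'Z(G)).
Proof.
by case/pCentP=> x [xG xZ ->]; apply/subsetPn; exists x => //; apply: cent1_id.
Qed.

(** * The central quotient when there are six proper centralizers *)

Lemma abelian_quotient_center :
  #|pCent G| = 6 -> 'Z(G / 'Z(G)) != 1 -> abelian (G / 'Z(G)).
Proof.
move=> P6 Z1; set Z := 'Z(G).
have nZ : G \subset 'N(Z) by apply: normal_norm; apply: center_normal.
have z0 : 0 < #|Z| by apply: cardG_gt0.
have cardq (K : {group gT}) : K \subset G -> Z \subset K ->
    #|K| = (#|K / Z| * #|Z|)%N.
  by move=> sKG sZK; rewrite card_quotient ?(subset_trans sKG) // mulnC Lagrange.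
have eD D : D \in pCent G -> exists2 K : {group gT}, D = K
    & [/\ K \subset G, Z \subset K & #|K| = (#|K / Z| * #|Z|)%N].
  move=> DC; have [K eK] := mem_pCent_group DC.
  have sK := pCent_sub DC; have sZ := center_sub_pCent DC.
  by exists K => //; rewrite -eK; split=> //; rewrite eK -?cardq -?eK.
have le5 D : D \in pCent G -> #|D / Z| <= 5.
  move=> DC; have := leq_card_pCent DC; rewrite P6.
  by case: (eD D DC) => K -> [_ _ ->]; rewrite leq_pmul2r.
(* A nontrivial coset of [x] lies in ['C_G[x] / Z], whose order is at most [P - 1 = 5]. *)
have ord5 u : u \in G / Z -> #[u] <= 5.
  case/morphimP=> x nx xG /= ->.
  case xZ: (x \in Z); first by rewrite coset_id ?order1.
  have xC := cent1_pCent xG (negbT xZ).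
  apply: leq_trans (le5 _ xC); apply: dvdn_leq; rewrite ?cardG_gt0 //.
  by apply: order_dvdG; apply: mem_quotient; apply: cent1_id.
have [p p_pr pZ] : exists2 p, prime p & p %| #|'Z(G / Z)|.
  by exists (pdiv #|'Z(G / Z)|); rewrite ?pdiv_dvd ?pdiv_prime ?cardG_gt1.
have [u uZ ou] := Cauchy p_pr pZ.
(* An element of prime order [q != p] times the central [u] would have order [p * q], at least 6. *)
have pQ : p.-group (G / Z).
  apply/pgroupP=> q q_pr qG; rewrite inE; apply: contraT => neqp.
  have [v vG ov] := Cauchy q_pr qG.
  have /centerP[uG cu] := uZ.
  have := ord5 (u * v) (groupM uG vG); rewrite orderM; last 2 first.
  - exact: cu.
  - by rewrite ou ov prime_coprime // dvdn_prime2 // eq_sym.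
  rewrite ou ov; have := prime_gt1 p_pr; have := prime_gt1 q_pr.
  move/eqP: neqp; nia.
have pD D : D \in pCent G -> p %| #|D / Z|.
  move=> DC; case: (eD D DC) (pCent_not_sub_center DC) => K -> [sKG sZK _] nKZ.
  have pK : p.-group (K / Z) by apply: pgroupS pQ; apply: quotientS.
  have [] // := pgroup_pdiv pK.
  rewrite -subG1 quotient_sub1 //; exact: subset_trans nZ.
have := sum_card_pCent; rewrite P6 -/Z.
rewrite (cardq G) ?center_sub //.
rewrite (eq_bigr (fun D : {set gT} => #|D / Z| * #|Z|)%N); last first.
  by move=> D DC; case: (eD D DC) => K -> [].
rewrite -big_distrl /= => eS.
have {}eS : (\sum_(D in pCent G) #|D / Z| = #|G / Z| + 5)%N.
  apply/eqP; rewrite -(eqn_pmul2r z0) -(eqn_add2r #|Z|) eS mulnDl -addnA.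
  by rewrite -mulSnr.
(* All the [D / Z] are nontrivial [p]-groups; as [p] also divides [#|G / Z|], it divides 5. *)
have pS : p %| #|G / Z| + 5 by rewrite -eS; apply: dvdn_sum.
have p5 : p = 5.
  apply/eqP; rewrite -dvdn_prime2 // -(dvdn_addr 5 (m := #|G / Z|)) //.
  exact: dvdn_trans pZ (cardSg (center_sub _)).
have nabG : ~~ abelian G.
  by apply: contra_eqN P6 => /pCent_abelian->; rewrite cards0.
have := leq_card_G nabG; rewrite P6 (cardq G) ?center_sub // leq_pmul2r //.
rewrite (card_pgroup pQ) p5 -[(_.-1 ^ 2)%N]/(5 ^ 2)%N leq_exp2l // => lelog.
by apply: (@p2group_abelian _ 5); rewrite ?p5 // -p5.
Qed.

(** * Centerless groups do not have exactly seven proper centralizers *)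

Section Centerless.

Hypothesis Z1 : 'Z(G) = 1.

(** Let [y] in [D] have order [p], and let [w] be a nontrivial central element of a Sylow subgroup
    containing [y]. Since [w] commutes with [y], [D = 'C_G[y] = 'C_G[w]] contains that whole Sylow
    subgroup. The witness [w] serves in [pCent_conj]. *)
Lemma pCent_Sylow p D : D \in pCent G -> prime p -> p %| #|D| ->
  exists2 S : {group gT}, p.-Sylow(G) S &
  S \subset D /\ exists2 w, w \in S & w \notin 'Z(G).
Proof.
move=> DC p_pr pD; have [K eK] := mem_pCent_group DC.
have sDG := pCent_sub DC.
move: pD; rewrite {1}eK => pK; have [y yK oy] := Cauchy p_pr pK.
have yD : y \in D by rewrite eK.
have yG := subsetP sDG y yD.
have yZ : y \notin 'Z(G).
  by rewrite Z1 inE -order_gt1 oy prime_gt1.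
have syG : <[y]> \subset G by rewrite cycle_subG.
have py : p.-group <[y]> by rewrite /pgroup -orderE oy pnat_id.
have [P sylP] := Sylow_superset syG py; rewrite cycle_subG => yP.
have sPG := pHall_sub sylP.
exists P => //.
have : 'Z(P) != 1.
  apply: contra yZ => /eqP ZP.
  by move: yP; rewrite (trivg_center_pgroup (pHall_pgroup sylP) ZP) inE Z1 inE.
case/trivgPn=> w /centerP[wP cw] w1.
have wZ : w \notin 'Z(G) by rewrite Z1 inE.
have wG := subsetP sPG w wP.
split; last by exists w.
rewrite (pCent_mem_eq DC yD yZ).
have wCy : w \in 'C_G[y] by rewrite mem_cent1 wG cw ?eqxx.
rewrite (cent1_eq_noncentral yG yZ wCy wZ).
apply/subsetP=> v vP; by rewrite mem_cent1 (subsetP sPG) ?cw ?eqxx.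
Qed.

(** This is the Hall property: [D] contains a full Sylow subgroup of [G] for every prime dividing
    its order. *)
Lemma pCent_coprime D : D \in pCent G -> coprime #|D| (#|G| %/ #|D|).
Proof.
move=> DC; apply: contraT => ncop.
have [p p_pr] : exists2 p, prime p & p %| gcdn #|D| (#|G| %/ #|D|).
  have [K eK] := mem_pCent_group DC.
  exists (pdiv (gcdn #|D| (#|G| %/ #|D|))); rewrite ?pdiv_dvd ?pdiv_prime //.
  by rewrite ltn_neqAle eq_sym ncop gcdn_gt0 eK cardG_gt0.
rewrite dvdn_gcd => /andP[pD].
have [S sylS [sSD _]] := pCent_Sylow DC p_pr pD.
have [K eK] := mem_pCent_group DC; have sDG := pCent_sub DC.
move: sSD sDG; rewrite eK => sSK sKG; rewrite divgS // => pi.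
case/and3P: sylS => _ _; rewrite p'natE // => /negP[].
exact: dvdn_trans pi (indexgS G sSK).
Qed.

Lemma pCent_part_dvd p D : D \in pCent G -> prime p -> p %| #|D| ->
  #|G|`_p %| #|D|.
Proof.
move=> DC p_pr pD; have [S sylS [sSD _]] := pCent_Sylow DC p_pr pD.
rewrite -(card_Hall sylS); have [K eK] := mem_pCent_group DC.
by move: sSD; rewrite eK; apply: cardSg.
Qed.

(** Sylow subgroups of [D] and [E] are conjugate in [G], and [D = 'C_G[w]], [E = 'C_G[w ^ g]] for a
    nontrivial [w] in the first one. *)
Lemma pCent_conj p D E : D \in pCent G -> E \in pCent G -> prime p ->
  p %| #|D| -> p %| #|E| -> exists2 g, g \in G & E = D :^ g.
Proof.
move=> DC EC p_pr pD pE.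
have [S sylS [sSD [w wS wZ]]] := pCent_Sylow DC p_pr pD.
have [T sylT [sTE _]] := pCent_Sylow EC p_pr pE.
have [g gG eT] := Sylow_trans sylS sylT; exists g => //.
have wgE : w ^ g \in E by rewrite (subsetP sTE) // eT memJ_conjg.
have wgZ : w ^ g \notin 'Z(G).
  by move: wZ; rewrite Z1 !inE conjg_eq1.
rewrite (pCent_mem_eq DC (subsetP sSD w wS) wZ).
by rewrite (pCent_mem_eq EC wgE wgZ) cent1J conjIg (conjGid gG).
Qed.

Lemma prime_pCent p : prime p -> p %| #|G| ->
  exists2 D, D \in pCent G & p %| #|D|.
Proof.
move=> p_pr pG; have [y yG oy] := Cauchy p_pr pG.
have yZ : y \notin 'Z(G) by rewrite Z1 inE -order_gt1 oy prime_gt1.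
exists 'C_G[y]; first exact: cent1_pCent.
by rewrite -oy order_dvdG ?cent1_id.
Qed.

Lemma pCent_card_gt1 D : D \in pCent G -> 1 < #|D|.
Proof.
move=> DC; have [K eK] := mem_pCent_group DC.
by have := pCent_not_sub_center DC; rewrite Z1 eK subG1 cardG_gt1.
Qed.

(** If [D] were normal, its Sylow 2-subgroup, characteristic because [D] is abelian, would be normal
    in [G]; being of order 2, it would be central. *)
Lemma pCent_sylow2_not_invariant D : D \in pCent G -> (#|D|`_2)%N = 2 ->
  exists2 g, g \in G & D :^ g != D.
Proof.
move=> DC D2; case: (boolP [forall g in G, D :^ g == D]); last first.
  by rewrite negb_forall_in => /exists_inP[g gG ?]; exists g.
move=> /forall_inP nDG; have [K eK] := mem_pCent_group DC.
have abK : abelian K.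
  by rewrite -eK; case/pCentP: DC => x [xG xZ ->]; apply: abC.
have nK : K <| G.
  rewrite /normal -eK pCent_sub //=.
  by apply/normsP=> g gG; apply/eqP/nDG.
have [P sylP] := Sylow_exists 2 K.
have cP : #|P| = 2 by rewrite (card_Hall sylP) -eK.
have nP : P <| G.
  rewrite (nilpotent_Hall_pcore (abelian_nil abK) sylP).
  exact: char_normal_trans (pcore_char _ _) nK.
have [y yP oy] : {y | y \in P & #[y] = 2} by apply: Cauchy; rewrite ?cP.
have eP : gval P = [set 1; y].
  rewrite -(cycle2g oy); apply/esym/eqP.
  by rewrite eqEcard cycle_subG yP cP -orderE oy.
have yG := subsetP (normal_sub nP) y yP.
have y1 : y != 1 by rewrite -order_gt1 oy.
suff : y \in 'Z(G) by rewrite Z1 inE (negPf y1).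
apply/centerP; split=> // g gG.
have : y ^ g \in P by rewrite memJ_norm // (subsetP (normal_norm nP)).
by rewrite eP !inE conjg_eq1 (negPf y1) /= => /eqP/conjg_fixP/commgP.
Qed.

Lemma card_pCent_centerless_neq7 : #|pCent G| <> 7.
Proof.
move=> P7.
have nabG : ~~ abelian G.
  by apply: contra_eqN P7 => /pCent_abelian->; rewrite cards0.
have ge2 := pCent_card_gt1.
have le6 D : D \in pCent G -> #|D| <= 6.
  by move=> DC; have := leq_card_pCent DC; rewrite P7 Z1 cards1 muln1.
have dvdG D : D \in pCent G -> #|D| %| #|G|.
  by move=> DC; have [K eK] := mem_pCent_group DC; rewrite eK cardSg -?eK ?pCent_sub.
have le36 : #|G| <= 36.
  by have := leq_card_G nabG; rewrite P7 Z1 cards1 muln1.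
(* 60 is the least common multiple of 2, ..., 6, and each primary part of [#|G|] divides the order
   of some proper centralizer. *)
have dvd60 : #|G| %| 60.
  apply/dvdn_partP => // p; rewrite mem_primes => /and3P[p_pr _ pG].
  have [D DC pD] := prime_pCent p_pr pG.
  apply: dvdn_trans (pCent_part_dvd DC p_pr pD) _.
  have := le6 D DC; have := ge2 D DC; case: #|D| => [|[|[|[|[|[|[|?]]]]]]] // _ _.
pose m (j : nat) : nat := #|[set D in pCent G | #|D| == j]|.
(* Grouping by order: [F = 1] gives the number of centralizers, [F = id] the sum of their orders,
   which is [#|G| + 6]. *)
have sumF (F : nat -> nat) : (\sum_(D in pCent G) F #|D|
    = m 2 * F 2 + m 3 * F 3 + m 4 * F 4 + m 5 * F 5 + m 6 * F 6)%N.
  rewrite (eq_bigr (fun D => \sum_(2 <= j < 7 | #|D| == j) F j)%N); last first.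
    move=> D DC; rewrite big_mkcond; have := le6 D DC; have := ge2 D DC.
    move: #|D| => c; rewrite unlock /=.
    by case: c => [|[|[|[|[|[|[|]]]]]]] //= _ _; rewrite ?addn0.
  rewrite (exchange_big_dep xpredT) //=.
  rewrite (eq_bigr (fun j => m j * F j)%N); last first.
    move=> j _; rewrite -sum_nat_const; apply: eq_bigl => D; by rewrite inE.
  by rewrite unlock /= addn0 !addnA.
have m7 : (m 2 + m 3 + m 4 + m 5 + m 6 = 7)%N.
  by have := sumF (fun=> 1%N); rewrite sum1_card P7 !muln1.
have := sum_card_pCent; rewrite P7 Z1 cards1 (sumF id) => mG.
have m0 j : ~~ ((j %| #|G|) && coprime j (#|G| %/ j)) -> m j = 0.
  move=> nj; apply/eqP; rewrite cards_eq0; apply/set0Pn => -[D].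
  rewrite inE => /andP[DC /eqP eD]; move/negP: nj; apply.
  by rewrite -eD dvdG ?pCent_coprime.
have : #|G| \in [:: 10; 12; 15; 20; 30]%N.
  (* Seven orders, each at least 2, sum to [#|G| + 6]. *)
  have ge8 : 8 <= #|G| by lia.
  have : #|G| \in divisors 60 by rewrite -dvdn_divisors.
  rewrite (_ : divisors 60 = [:: 1; 2; 3; 4; 5; 6; 10; 12; 15; 20; 30; 60]%N) //.
  rewrite !inE; lia.
rewrite !inE => /or4P[/eqP N|/eqP N|/eqP N|/orP[/eqP N|/eqP N]];
  rewrite N in mG m0.
- have [[? ?] ?] := (m0 3 isT, m0 4 isT, m0 6 isT); lia.
- have [[? ?] ?] := (m0 2 isT, m0 5 isT, m0 6 isT); lia.
- have [[? ?] ?] := (m0 2 isT, m0 4 isT, m0 6 isT).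
  have [D DC D5] : exists2 D, D \in pCent G & 5 %| #|D|.
    by apply: prime_pCent; rewrite ?N.
  have : 0 < m 5.
    apply/card_gt0P; exists D; rewrite inE DC /=.
    by have := le6 D DC; have := ge2 D DC; move: D5; case: #|D| => [|[|[|[|[|[|[|]]]]]]].
  lia.
- have [[? ?] ?] := (m0 2 isT, m0 3 isT, m0 6 isT); lia.
have m4 := m0 4 isT.
(* Here [#|G| = 30]: seven orders of at most 5 cannot sum to 36. *)
have m6 : 0 < m 6 by lia.
have /card_gt0P[D] := m6; rewrite inE => /andP[DC /eqP D6].
have conjD p E : prime p -> p %| 6 -> E \in pCent G -> p %| #|E| ->
    #|E| = 6.
  move=> p_pr p6 EC pE; have pD : p %| #|D| by rewrite D6.
  by have [g _ ->] := pCent_conj DC EC p_pr pD pE; rewrite cardJg.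
have mp p : prime p -> p %| 6 -> p != 6 -> m p = 0.
  move=> p_pr p6 np6; apply/eqP; rewrite cards_eq0; apply/set0Pn => -[E].
  rewrite inE => /andP[EC /eqP eE]; case/eqP: np6.
  by rewrite -eE (conjD p E) ?eE.
(* Only the orders 5 and 6 remain, and [36 = 7 * 5 + 1]. *)
have m6_1 : m 6 = 1%N by have [? ?] := (mp 2 isT isT isT, mp 3 isT isT isT); lia.
have [g gG] : exists2 g, g \in G & D :^ g != D.
  by apply: pCent_sylow2_not_invariant; rewrite // D6 p_part.
have DgC : D :^ g \in pCent G.
  have /pCentP[x [xG xZ eD]] := DC.
  rewrite eD conjIg (conjGid gG) -cent1J; apply: cent1_pCent.
    by rewrite groupJ.
  by move: xZ; rewrite Z1 !inE conjg_eq1.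
have /eqP/cards1P[D0 eD0] := m6_1.
have : D \in [set D0] by rewrite -eD0 inE DC D6 /=.
have : D :^ g \in [set D0] by rewrite -eD0 inE DgC cardJg D6 /=.
by rewrite !inE => /eqP-> /eqP->; rewrite eqxx.
Qed.

End Centerless.

End AbelianCentralizers.

End NoncentralCentralizers.

(** * Assembly of the two assertions *)

Lemma card_Cent2_eq8 (gT : finGroupType) (G : {group gT}) :
  #|Cent2 G| = 8 <-> #|pCent G| = 6 /\ 'Z(G) <> 1.
Proof.
split=> [C8|[P6 /eqP Z1]].
  have nabG : ~~ abelian G.
    by apply: contra_eqN C8 => /card_Cent2_abelian; case: #|_| => [|[]].
  (* This strict bound holds without knowing that centralizers are abelian, and it is what makes
     [abelian_pCent] applicable. *)
  have ltP := card_pCent_lt_Cent2 nabG; rewrite C8 in ltP.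
  have abC x := @abelian_pCent _ G x ltP.
  have := card_Cent2 abC nabG; rewrite C8.
  case: (eqVneq 'Z(G) 1) => [Z1|/eqP Z1] /=; last by rewrite !addn1 => -[/esym].
  by rewrite addn0 addn1 => -[/esym e]; case: (card_pCent_centerless_neq7 abC Z1).
have nabG : ~~ abelian G.
  by apply: contra_eqN P6 => /pCent_abelian->; rewrite cards0.
have abC x : x \in G -> x \notin 'Z(G) -> abelian 'C_G[x].
  by apply: abelian_pCent; rewrite P6.
by rewrite card_Cent2 // P6 Z1.
Qed.

Theorem theorem4p8 (gT : finGroupType) (G : {group gT}) :
  (centralizer2_group 8 G <-> (centralizer_group 7 G /\ 'Z(G) <> 1))
  /\ ~ primitive_centralizer2_group 8 G.
Proof.
rewrite /centralizer2_group /centralizer_group card_Cent; split.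
  by rewrite card_Cent2_eq8; split=> -[] => [->|[]].
(* The criterion is applied to [G] for [P = 6] and to [G / 'Z(G)] for its nontrivial center; the
   quotient is then abelian and has at most one 2-centralizer. *)
case=> /card_Cent2_eq8[P6 _] C8; have /card_Cent2_eq8[_ /eqP Z1] := C8.
have abC x : x \in G -> x \notin 'Z(G) -> abelian 'C_G[x].
  by apply: abelian_pCent; rewrite P6.
by have := card_Cent2_abelian (abelian_quotient_center abC P6 Z1); rewrite C8.
Qed.
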